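(* Consider $f \colon \mathbb{N} \times \mathbb{N} \to \mathbb{Z}$ with $f(a,b) = p(a) + q(b)$, where $p$ and $q$ are non-decreasing polynomial functions of degree $\alpha = \deg p$ and $\beta = \deg q$, respectively. Assuming $1 \le \alpha \le \beta$, the bimonotone enumeration algorithm (described in the context) applied to $f$ requires memory $m \in \Theta(n^\varepsilon)$ with exponent $\varepsilon = \frac{\alpha}{\alpha+\beta}$, where $m$ denotes the length of the priority queue built up while enumerating the first $n$ values of $f$.
   Context: $\mathbb{N}=\{0,1,2,\dots\}$. The bound is asymptotic for $n\to\infty$, with $f$ fixed. Bimonotone enumeration algorithm, for a proper bimonotone $f\colon A\times B\to Z$ (here $A=B=\mathbb{N}$, $Z=\mathbb{Z}$; bimonotone means $a\le a'$ and $b\le b'$ imply $f(a,b)\le f(a',b')$; proper means that for each $z\in \operatorname{Im}(f)$ only finitely many pairs satisfy $f(a,b)\le z$). For $a\in A$ let $\sigma a$ denote the successor of $a$, and similarly for $b\in B$; let $a_{\min},b_{\min}$ be the least elements. The algorithm maintains a doubly linked list $M$ of pairs in $A\times B$ and a priority queue $F$ containing the values $f(a,b)$ for $(a,b)\in M$, each stored with a pointer to its pair $(a,b)$ in $M$. By convention the predecessor of the first element of $M$ is $(-\infty,+\infty)$ and the successor of the last element of $M$ is $(+\infty,-\infty)$. (1) Initialize $M=\langle (a_{\min},b_{\min})\rangle$ and $F=\langle f(a_{\min},b_{\min})\rangle$. (2) While $F$ is non-empty: remove a minimal element $f(a,b)$ from $F$ and output $(a,b)$; let $(a^*,b_* )$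 be the successor of $(a,b)$ in $M$; if $\sigma a<a^*$, insert $(\sigma a,b)$ into $M$ right after $(a,b)$ and insert $f(\sigma a,b)$ into $F$; let $(a_*,b^* )$ be the predecessor of $(a,b)$ in $M$; if $\sigma b<b^*$, insert $(a,\sigma b)$ into $M$ right after $(a,b)$ and insert $f(a,\sigma b)$ into $F$; remove $(a,b)$ from $M$. *)

(* Defs.v *)
From HB Require Import structures.
From mathcomp Require Import all_boot all_order all_algebra.
From mathcomp Require Import all_classical all_reals all_analysis.

Set Implicit Arguments.
Unset Strict Implicit.
Unset Printing Implicit Defensive.

Import Order.TTheory GRing.Theory Num.Theory.
Import numFieldNormedType.Exports.

Local Open Scope ring_scope.

(* [Mlist] is the list [M] and [Fqueue] the priority queue [F].  A pointer into
   [M] is represented by the pair it points to, the pairs stored in [M] being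
   pairwise distinct.  The order of the entries in [Fqueue] carries no
   information. *)
Record state := State {
  Mlist : seq (nat * nat);
  Fqueue : seq (int * (nat * nat));
  outputs : seq (nat * nat)
}.

Definition init (f : nat * nat -> int) : state :=
  State [:: (0, 0)%N] [:: (f (0, 0)%N, (0, 0)%N)] [::].

Definition ext (x : nat * nat) : \bar int * \bar int :=
  ((x.1%:Z)%:E, (x.2%:Z)%:E).

Definition successor (x : nat * nat) (l : seq (nat * nat)) : \bar int * \bar int :=
  nth (+oo, -oo)%E (map ext l) (index x l).+1.

(* The shift of positions by the extra head makes the [index x l]-th element of
   the extended list the one preceding [x] in [l]. *)
Definition predecessor (x : nat * nat) (l : seq (nat * nat)) : \bar int * \bar int :=
  nth (-oo, +oo)%E ((-oo, +oo)%E :: map ext l) (index x l).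

Definition insert_after (x y : nat * nat) (l : seq (nat * nat)) : seq (nat * nat) :=
  take (index x l).+1 l ++ y :: drop (index x l).+1 l.

Definition process (f : nat * nat -> int) (e : int * (nat * nat)) (s : state) : state :=
  let: (a, b) := e.2 in
  let F0 := rem e (Fqueue s) in
  let a_up := (successor (a, b) (Mlist s)).1 in
  let: (M1, F1) :=
    if ((a.+1%:Z)%:E < a_up)%E
    then (insert_after (a, b) (a.+1, b) (Mlist s), (f (a.+1, b), (a.+1, b)) :: F0)
    else (Mlist s, F0) in
  let b_up := (predecessor (a, b) M1).2 in
  let: (M2, F2) :=
    if ((b.+1%:Z)%:E < b_up)%E
    then (insert_after (a, b) (a, b.+1) M1, (f (a, b.+1), (a, b.+1)) :: F1)
    else (M1, F1) in
  State (rem (a, b) M2) F2 (rcons (outputs s) (a, b)).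

Definition minimal_entry (e : int * (nat * nat)) (l : seq (int * (nat * nat))) : Prop :=
  e \in l /\ forall e', e' \in l -> e.1 <= e'.1.

(* The choice among several minimal entries is left open.  Once the queue is
   empty the loop has ended and the state no longer changes. *)
Definition step (f : nat * nat -> int) (s s' : state) : Prop :=
  (Fqueue s = [::] /\ s' = s) \/
  (exists e, minimal_entry e (Fqueue s) /\ s' = process f e s).

Definition run (f : nat * nat -> int) (s : nat -> state) : Prop :=
  s 0%N = init f /\ forall k, step f (s k) (s k.+1).

(* Every iteration outputs one pair, so that [s 0], ..., [s n] are the states
   passed through while the first [n] values are enumerated.  The memory
   required is the largest length of the queue in these states; inside an
   iteration the queue is never longer than before or after it. *)
Definition memory (s : nat -> state) (n : nat) : nat :=
  \max_(k < n.+1) size (Fqueue (s k)).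

(* Main.v *)
(* The enumerated pairs form a lower set O, and M lists the minimal pairs of its
   complement, so the queue length m is the number of corners of the staircase
   bounding O.  Let A and B be the extents of O along the two axes.  As f is at
   most as large on O as outside O, comparing values gives A^alpha = Theta(B^beta)
   and n = |O| = Theta(A B), whence B = Theta(n^(alpha / (alpha + beta))).  The
   corners lie in distinct rows, so m <= B + 1.  Conversely, above height B / 2 a
   step of q is, since alpha <= beta, at least a constant multiple of any step of
   p inside O, so rows a bounded distance apart have different widths, and each
   width occurs at a corner: m = Theta(B). *)
Require Import Defs.
From HB Require Import structures.
From mathcomp Require Import all_boot all_order all_algebra.
From mathcomp Require Import all_classical all_reals all_analysis.
From mathcomp Require Import zify ring lra.
Import Order.TTheory GRing.Theory Num.Theory.
Import numFieldNormedType.Exports.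
Local Open Scope classical_set_scope.
Local Open Scope ring_scope.

(** * Staircases and growth conditions *)

Definition le_pair (x y : nat * nat) := ((x.1 <= y.1) && (x.2 <= y.2))%N.

Definition before (x y : nat * nat) := ((x.1 < y.1) && (y.2 < x.2))%N.

(* [O] is a finite lower set and [M] lists, by increasing first coordinate, the
   minimal pairs of its complement. *)
Definition frontier (O M : seq (nat * nat)) :=
  pairwise before M /\ forall y, (y \notin O) = has (le_pair^~ y) M.

(* The increments of [P] are of exact order [a ^ d]; as [P] has degree [d + 1], no
   zero degree has to be excluded. *)
Definition growth (d C N : nat) (P : nat -> nat) :=
  [/\ P 0 = 0, {homo P : a b / a <= b},
      forall a, P a.+1 <= P a + C * a.+1 ^ d &
      forall a, N <= a -> a ^ d + C * P a <= C * P a.+1]%N.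

Lemma leq_expn2r (e m n : nat) : (m <= n -> m ^ e <= n ^ e)%N.
Proof. by case: e => // e mn; rewrite leq_exp2r. Qed.

(** * Sums of increments of polynomial order *)

Section Growth.

Variables (d C N : nat) (P : nat -> nat).
Hypothesis hP : growth d C N P.

Lemma growth_pred (a : nat) :
  (0 < a -> P a <= P a.-1 + C * a ^ d)%N.
Proof. by case: hP => _ _ h _; case: a => // a _; exact: h. Qed.

Lemma growth_ub (a : nat) : (P a <= C * a ^ d.+1)%N.
Proof.
case: hP => P0 _ hup _; elim: a => [|a IH]; first by rewrite P0.
apply: (leq_trans (hup a)).
rewrite [in leqRHS]expnS.
have : (a ^ d.+1 <= a.+1 ^ d * a)%N by rewrite expnSr leq_mul2r leq_expn2r ?orbT //.
nia.
Qed.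

Lemma growth_lb (a k : nat) :
  (N <= a -> k * a ^ d + C * P a <= C * P (a + k))%N.
Proof.
case: hP => _ _ _ hlo Na; elim: k => [|k IH]; first by rewrite addn0.
have := hlo (a + k)%N ltac:(lia).
have : (a ^ d <= (a + k) ^ d)%N by rewrite leq_expn2r ?leq_addr.
rewrite addnS; nia.
Qed.

(** Between [a./2] and [a.-1] there are at least [a / 4] steps, each gaining at least
    [a./2 ^ d / C]. The end point is [a.-1] because an extent of the lower set is the first position
    outside it. *)
Lemma growth_half (a : nat) : (2 * N + 8 <= a ->
  a ^ d.+1 + 4 ^ d.+1 * (C * P a./2) <= 4 ^ d.+1 * (C * P a.-1))%N.
Proof.
move=> Na; have a2 := half_leq (leqnn a).
have := growth_lb a./2 (a.-1 - a./2) ltac:(lia).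
rewrite (_ : a./2 + _ = a.-1)%N; last by lia.
have : (a ^ d.+1 <= 4 * (a.-1 - a./2) * (4 * a./2) ^ d)%N.
  by rewrite expnS leq_mul ?leq_expn2r //; lia.
rewrite expnMn [(4 ^ d.+1)%N]expnS.
move: (4 ^ d)%N (a./2 ^ d)%N (a.-1 - a./2)%N => u v t; nia.
Qed.

End Growth.

(** * Geometry of a finite lower set and its corners *)

Section Frontier.

Variables (O M : seq (nat * nat)).
Hypothesis OM : frontier O M.

Lemma frontier_lower (x y : nat * nat) : le_pair x y -> y \in O -> x \in O.
Proof.
case: OM => _ hO xy; apply: contraLR; rewrite !hO => /hasP[z zM /andP[zx zx']].
by apply/hasP; exists z => //; move/andP: xy => [? ?]; apply/andP; split; lia.
Qed.

Lemma frontier_notin (x : nat * nat) : x \in M -> x \notin O.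
Proof.
by case: OM => _ hO xM; rewrite hO; apply/hasP; exists x; rewrite // /le_pair !leqnn.
Qed.

Lemma frontier_antichain (x y : nat * nat) :
  x \in M -> y \in M -> le_pair x y -> x = y.
Proof.
case: OM => + _; elim: M x y => // z M' IH x y /= /andP[/allP hz pM].
rewrite !inE => /orP[/eqP->|xM] /orP[/eqP->|yM] //; last exact: IH.
- by have := hz _ yM; rewrite /before /le_pair; lia.
- by have := hz _ xM; rewrite /before /le_pair; lia.
Qed.

(** The chain [g] leaves the finite set [O] by the pigeonhole principle; the least index outside is
    the cut. Rows and columns are such chains. *)
Lemma extentP (g : nat -> nat * nat) :
    injective g -> {homo g : a b / (a <= b)%N >-> le_pair a b} ->
  exists w, forall a, (g a \in O) = (a < w)%N.
Proof.
move=> gi gh.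
have ex : exists a, g a \notin O.
  suff : ~~ all (mem O \o g) (iota 0 (size O).+1).
    by case/allPn => a _ /= ?; exists a.
  apply/negP => /allP h.
  have : (size (map g (iota 0 (size O).+1)) <= size O)%N.
    apply: uniq_leq_size; first by rewrite map_inj_uniq ?iota_uniq.
    by move=> _ /mapP[a + ->] => /h.
  by rewrite size_map size_iota ltnn.
exists (ex_minn ex) => a; case: ex_minnP => w wO wmin.
apply/idP/idP => [aO|]; last first.
  by apply: contraLR => /wmin; rewrite -leqNgt.
rewrite ltnNge; apply: contra wO => wa.
exact: frontier_lower _ _ (gh _ _ wa) aO.
Qed.

Lemma extents : exists w h : nat -> nat,
  forall a b, ((a, b) \in O) = (a < w b)%N /\ ((a, b) \in O) = (b < h a)%N.
Proof.
have /choice[w hw] b : exists w, forall a, ((a, b) \in O) = (a < w)%N.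
  apply: (extentP (fun a => (a, b))) => [? ? []//|a a' aa'].
  by rewrite /le_pair /= aa' /=.
have /choice[h hh] a : exists h, forall b, ((a, b) \in O) = (b < h)%N.
  apply: (extentP (fun b => (a, b))) => [? ? []//|b b' bb'].
  by rewrite /le_pair /= bb' leqnn.
by exists w, h.
Qed.

Variables (w h : nat -> nat).
Hypothesis hwh :
  forall a b, ((a, b) \in O) = (a < w b)%N /\ ((a, b) \in O) = (b < h a)%N.

Let hw a b : ((a, b) \in O) = (a < w b)%N. Proof. by case: (hwh a b). Qed.
Let hh a b : ((a, b) \in O) = (b < h a)%N. Proof. by case: (hwh a b). Qed.

Lemma width_anti (b b' : nat) : (b <= b' -> w b' <= w b)%N.
Proof.
move=> bb'; rewrite leqNgt -hw; apply/negP.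
move=> /(frontier_lower (w b, b)).
by rewrite hw ltnn /le_pair /= leqnn bb' => /(_ isT).
Qed.

Lemma size_frontier_le : (size M <= (h 0).+1)%N.
Proof.
have u1 : uniq (map snd M).
  rewrite map_inj_in_uniq.
    case: OM => + _; elim: M => // z M' IH /= /andP[/allP hz /IH ->].
    by rewrite andbT; apply/negP => /hz; rewrite /before ltnn.
  move=> x y xM yM exy; have [le|le] := leqP x.1 y.1.
    by apply: frontier_antichain; rewrite // /le_pair le exy /=.
  apply/esym/frontier_antichain; rewrite // /le_pair exy leqnn andbT. exact: ltnW.
rewrite -(size_map snd) -(size_iota 0 (h 0).+1); apply: uniq_leq_size => //.
move=> _ /mapP[[a b] xM ->]; rewrite mem_iota /= add0n ltnS leqNgt.
apply/negP => hb.
(* A corner above height [h 0] would dominate the corner below [(0, h 0)]. *)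
have : (0, h 0)%N \notin O by rewrite hh ltnn.
case: OM => _ -> /hasP[[a' b'] yM /andP[/= a'0 b'h]].
have : (a', b') = (a, b) by apply: frontier_antichain; rewrite // /le_pair /=; lia.
by case; lia.
Qed.

(** The point [(w b, b)] lies above some corner; a corner further left would lie below a point of
    row [b] inside [O]. *)
Lemma width_in_frontier (b : nat) : w b \in map fst M.
Proof.
have : (w b, b) \notin O by rewrite hw ltnn.
case: OM => _ -> /hasP[[a' b'] yM /andP[/= a'w b'b]].
apply/mapP; exists (a', b') => //=.
apply/eqP; rewrite eqn_leq a'w andbT leqNgt -hw.
apply: contra (frontier_notin _ yM).
by apply: frontier_lower; rewrite /le_pair /= leqnn.
Qed.

Lemma size_frontier_ge (g : nat -> nat) (J : nat) :
  (forall i j, i < j -> j < J -> w (g j) < w (g i))%N -> (J <= size M)%N.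
Proof.
move=> hg; rewrite -(size_map fst) -(size_iota 0 J) -(size_map (w \o g)).
apply: uniq_leq_size.
  rewrite map_inj_in_uniq ?iota_uniq // => i j; rewrite !mem_iota /= add0n => iJ jJ.
  by case: (ltngtP i j) => // [/hg/(_ jJ)|/hg/(_ iJ)]; lia.
by move=> _ /mapP[i _ ->] /=; exact: width_in_frontier.
Qed.

Lemma size_outputs_le : uniq O -> (size O <= w 0 * h 0)%N.
Proof.
rewrite -[w 0](size_iota 0) -[h 0](size_iota 0) -(size_allpairs pair).
move=> uO; apply: uniq_leq_size => // -[a b] abO.
apply/allpairsP; exists (a, b); rewrite !mem_iota /= !add0n.
rewrite -hw -hh; split => //; apply: frontier_lower _ _ _ abO;
by rewrite /le_pair /= ?leqnn.
Qed.

Lemma size_outputs_ge (b : nat) : (w b * b <= size O)%N.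
Proof.
rewrite -[w b](size_iota 0) -{2}[b](size_iota 0) -(size_allpairs pair).
apply: uniq_leq_size.
  by apply: allpairs_uniq; rewrite ?iota_uniq //= => -[? ?] [? ?] _ _ [-> ->].
move=> _ /allpairsP[[a b'] [+ + ->]] /=; rewrite !mem_iota /= !add0n => aw b'b.
rewrite hw; apply: leq_trans aw _; apply: width_anti; exact: ltnW.
Qed.

End Frontier.

(** * Number of corners against number of outputs *)

Section Sizes.

Variables (d e C N : nat) (P Q : nat -> nat).
Hypotheses (hP : growth d C N P) (hQ : growth e C N Q).
Variables (O M : seq (nat * nat)).
Hypotheses (OM : frontier O M) (O0 : (0 < size O)%N).
Hypothesis sep : forall a b a' b',
  (a, b) \in O -> (a', b') \notin O -> (P a + Q b <= P a' + Q b')%N.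

(** With B = [h 0], the comparison is made at half height: for x = B / 2 and y = [w x], the
    rectangle of sides y and x lies in [O], and [Q B.-1 <= P y + Q x] bounds B^(e+1) by a multiple
    of y^(d+1). Multiplying by B^(d+1) <= (4x)^(d+1) produces (xy)^(d+1), at most
    [size O ^ d.+1]. *)
Lemma size_frontier_ub :
  (size M ^ (d.+1 + e.+1) <=
   (8 ^ (d.+1 + e.+1) * C ^ 2 + (2 * N + 8) ^ (d.+1 + e.+1)) * size O ^ d.+1)%N.
Proof.
have [w [h hwh]] := extents O M OM.
have hw a b := (hwh a b).1; have hh a b := (hwh a b).2.
have mB := size_frontier_le O M OM w h hwh; set B := h 0%N in mB.
have n1 : (1 <= size O ^ d.+1)%N by rewrite expn_gt0 O0.
have [ltB|geB] := ltnP B (2 * N + 8).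
  have := leq_expn2r (d.+1 + e.+1) (size M) (2 * N + 8) ltac:(lia); nia.
set x := B./2; set y := w x.
have mB2 : (size M <= 2 * B)%N by lia.
have half := growth_half _ _ _ _ hQ _ geB; rewrite -/x in half.
have inO : (0, B.-1)%N \in O by rewrite hh -/B; lia.
have notinO : (y, x) \notin O by rewrite hw ltnn.
have sepxy := sep _ _ _ _ inO notinO; case: (hP) => P0 _ _ _; rewrite P0 in sepxy.
have Py := growth_ub _ _ _ _ hP y.
have Bx : (B <= 4 * x)%N by rewrite /x; lia.
have yx := size_outputs_ge O M OM w h hwh x; rewrite -/y in yx.
have By : (B ^ e.+1 <= 4 ^ e.+1 * (C * (C * y ^ d.+1)))%N.
  have : (4 ^ e.+1 * (C * Q B.-1) <=
          4 ^ e.+1 * (C * (C * y ^ d.+1)) + 4 ^ e.+1 * (C * Q x))%N.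
    by rewrite -!mulnDr !leq_mul2l; apply/orP; right; apply/orP; right; lia.
  lia.
apply: leq_trans (leq_expn2r _ _ _ mB2) _; rewrite expnMn [(B ^ _)%N]expnD.
have Bd := leq_expn2r d.+1 _ _ Bx; rewrite expnMn in Bd.
have nd := leq_expn2r d.+1 _ _ yx; rewrite expnMn in nd.
have -> : (8 ^ (d.+1 + e.+1) = 2 ^ (d.+1 + e.+1) * (4 ^ d.+1 * 4 ^ e.+1))%N.
  by rewrite -expnD -expnMn.
rewrite mulnDl; apply: leq_trans (leq_addr _ _).
rewrite -!mulnA leq_mul2l; apply/orP; right.
apply: leq_trans (leq_mul Bd By) _.
rewrite (_ : 4 ^ d.+1 * x ^ d.+1 * (4 ^ e.+1 * (C * (C * y ^ d.+1))) =
  4 ^ d.+1 * (4 ^ e.+1 * (C * (C * (y ^ d.+1 * x ^ d.+1)))))%N; last by ring.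
by rewrite !leq_mul2l nd !orbT.
Qed.

(** For the extents A = [w 0] and B = [h 0]: [D] is the constant in A^(d+1) <= D B^(e+1), rows of
    the upper half at least [K] apart have different widths, and B <= E * [size M]. *)
Let D := (4 ^ d.+1 * C ^ 2 + (2 * N + 8) ^ d.+1)%N.
Let K := (C ^ 2 * D * 4 ^ e).+1.
Let E := (4 * K + 2 * N + 1)%N.

(** [O] fits into the A by B rectangle, so its size is controlled by B alone through [D], and B is
    controlled by the number of distinct row widths. *)
Lemma size_outputs_ub : (d <= e)%N -> uniq O ->
  (size O ^ d.+1 <= D * E ^ (d.+1 + e.+1) * size M ^ (d.+1 + e.+1))%N.
Proof.
move=> de uO.
have [w [h hwh]] := extents O M OM.
have hw a b := (hwh a b).1; have hh a b := (hwh a b).2.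
have nAB := size_outputs_le O M OM w h hwh uO.
have w_anti := width_anti O M OM w h hwh.
set A := w 0%N in nAB; set B := h 0%N in nAB.
have [A1 B1] : (0 < A)%N /\ (0 < B)%N by split; nia.
have [P0 Pmono _ _] := hP; have [Q0 Qmono _ _] := hQ.
have inA : (A.-1, 0)%N \in O by rewrite hw -/A; lia.
have outB : (0, B)%N \notin O by rewrite hh -/B ltnn.
have sepAB := sep _ _ _ _ inA outB; rewrite P0 Q0 in sepAB.
have QB := growth_ub _ _ _ _ hQ B.
have AB : (A ^ d.+1 <= D * B ^ e.+1)%N.
  rewrite /D; have [ltA|geA] := ltnP A (2 * N + 8).
    have := leq_expn2r d.+1 A (2 * N + 8) ltac:(lia).
    have : (0 < B ^ e.+1)%N by rewrite expn_gt0 B1.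
    nia.
  have half := growth_half _ _ _ _ hP _ geA.
  have : (4 ^ d.+1 * (C * P A.-1) <= 4 ^ d.+1 * (C * (C * B ^ e.+1)))%N.
    by rewrite !leq_mul2l; apply/orP; right; apply/orP; right; lia.
  rewrite -mulnn; nia.
have D1 : (0 < D)%N by rewrite /D addn_gt0 [X in _ || X]expn_gt0 addn_gt0 !orbT.
(* This is where [d <= e] enters: for A <= B it compares the powers directly, otherwise [AB] is
   divided by A > B. It bounds a step of [P] inside [O] by the order of a step of [Q]. *)
have AB' : (A ^ d <= D * B ^ e)%N.
  have [leAB|ltBA] := leqP A B.
    have := leq_expn2r d A B leAB; have := leq_pexp2l B1 de; nia.
  rewrite -(leq_pmul2r B1) -mulnA -expnSr; apply: leq_trans AB.
  by rewrite expnSr leq_mul2l (ltnW ltBA) orbT.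
have BE : (B <= E * size M)%N.
  have M1 : (0 < size M)%N.
    by have := width_in_frontier O M OM w h hwh 0; case: (M).
  rewrite /E; have [ltx|gex] := ltnP B./2 N; first by nia.
  set x := B./2 in gex *.
  (* If both rows had the width [w b'], the pairs [(w b' - 1, b')] in [O] and
     [(w b', b)] outside [O] would bound [K] steps of [Q] by one step of [P]. *)
  have gap b b' : (x <= b -> b + K <= b' -> b' < B -> w b' < w b)%N.
    move=> xb bb' b'B; rewrite ltnNge; apply/negP => ww.
    have w0 : (0 < w b')%N by rewrite -hw hh.
    have wA : (w b' <= A)%N by exact: w_anti.
    have i1 : ((w b').-1, b') \in O by rewrite hw; lia.
    have i2 : (w b', b) \notin O by rewrite hw -leqNgt.
    have s12 := sep _ _ _ _ i1 i2.
    have Pw := growth_pred _ _ _ _ hP _ w0.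
    have Qb := growth_lb _ _ _ _ hQ b K ltac:(lia).
    have b0 : (0 < b ^ e)%N by rewrite expn_gt0; rewrite /x in xb; lia.
    have wb : (w b' ^ d <= D * (4 ^ e * b ^ e))%N.
      apply: leq_trans (leq_expn2r d _ _ wA) _; apply: leq_trans AB' _.
      by rewrite leq_mul2l -expnMn leq_expn2r ?orbT //; rewrite /x in xb; lia.
    have Qb' : (C * Q b' <= C * (Q b + C * w b' ^ d))%N.
      by rewrite leq_mul2l; apply/orP; right; lia.
    have : (C * Q (b + K) <= C * Q b')%N by rewrite leq_mul2l Qmono ?orbT.
    (* Together with [Qb] this yields K * b^e <= C^2 * D * 4^e * b^e, which the successor in [K]
       excludes. *)
    have : (C * (C * w b' ^ d) <= C ^ 2 * D * 4 ^ e * b ^ e)%N.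
      by rewrite mulnA -!mulnA !leq_mul2l wb !orbT.
    move: Qb; rewrite {1}/K mulSn; lia.
  (* The rows x, x + K, x + 2K, ... below 2x <= B have pairwise different widths. *)
  have JM : (x %/ K <= size M)%N.
    apply: (size_frontier_ge O M OM w h hwh (fun j => x + j * K)%N).
    move=> i j ij jJ; have jx : (j.+1 * K <= x)%N.
      by apply: leq_trans (leq_trunc_div x K); rewrite leq_mul2r jJ orbT.
    have ijK : (i.+1 * K <= j * K)%N by rewrite leq_mul2r ij orbT.
    have K0 : (0 < K)%N by [].
    by apply: gap; rewrite /x in jx *; lia.
  have xK : (x < (x %/ K).+1 * K)%N by rewrite ltn_ceil.
  have : ((x %/ K).+1 * K <= (2 * size M) * K)%N by rewrite leq_mul2r; lia.
  rewrite /x in xK *; nia.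
have nA := leq_expn2r d.+1 _ _ nAB; rewrite expnMn in nA.
apply: (leq_trans nA); rewrite -mulnA -[(E ^ _ * _)%N]expnMn.
apply: (@leq_trans (D * B ^ (d.+1 + e.+1))).
  by rewrite [(d.+1 + _)%N]addnC expnD mulnA leq_mul2r AB orbT.
by rewrite leq_mul2l leq_expn2r ?orbT.
Qed.

End Sizes.

(** * One iteration of the algorithm *)

(** Beyond [(a, b)] itself, the points above it are those above [(a.+1, b)] or [(a, b.+1)]. Corners
    in [l2] are lower and those in [l1] further left, so one coordinate decides whether a candidate
    is already dominated. *)
Lemma frontier_rcons (O l1 l2 : seq (nat * nat)) (a b : nat)
    (c1 := all (fun y => a.+1 < y.1)%N l2) (c2 := all (fun y => b.+1 < y.2)%N l1) :
  frontier O (l1 ++ (a, b) :: l2) ->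
  frontier (rcons O (a, b)) (l1 ++ (if c2 then [:: (a, b.+1)] else [::]) ++
                                   (if c1 then [:: (a.+1, b)] else [::]) ++ l2).
Proof.
case; rewrite pairwise_cat allrel_consr /= => /and4P[/andP[/allP l1x /allrelP l12]].
move=> p1 /allP xl2 p2 hO; split.
  have pc (s t : seq (nat * nat)) : pairwise before s -> pairwise before t ->
      (forall x y, x \in s -> y \in t -> before x y) -> pairwise before (s ++ t).
    by move=> ps pt /allrelP st; rewrite pairwise_cat ps pt st.
  apply: (pc) => //; first apply: (pc).
  - by case: ifP.
  - apply: (pc) => //; first by case: ifP.
    move=> x y; case: ifP => // /allP hc; rewrite inE => /eqP-> yl.
    by have := hc _ yl; have := xl2 _ yl; rewrite /before /=; lia.
  - move=> x y; case: ifP => // /allP hc; rewrite inE => /eqP->.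
    rewrite mem_cat => /orP[|yl].
      by case: ifP => // _; rewrite inE => /eqP->; rewrite /before /=; lia.
    by have := xl2 _ yl; rewrite /before /=; lia.
  - move=> x y xl; have hx := l1x _ xl; rewrite !mem_cat => /or3P[||yl].
    + case: ifP => // /allP/(_ _ xl) hc; rewrite inE => /eqP->.
      by move: hx hc; rewrite /before /=; lia.
    + case: ifP => // _; rewrite inE => /eqP->.
      by move: hx; rewrite /before /=; lia.
    + exact: l12.
move=> y; rewrite mem_rcons inE negb_or hO !has_cat /=.
have [/hasP[z zl zy]|/hasPn n1] := boolP (has (le_pair^~ y) l1).
  rewrite andbT; apply/eqP => yx.
  by have := l1x _ zl; move: zy; rewrite yx /before /le_pair /=; lia.
have [/hasP[z zl zy]|/hasPn n2] := boolP (has (le_pair^~ y) l2).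
  rewrite !orbT andbT; apply/eqP => yx.
  by have := xl2 _ zl; move: zy; rewrite yx /before /le_pair /=; lia.
(* When [c2] fails, some corner of [l1] lies below [(a, b.+1)], hence below everything above it,
   contrary to [n1]. *)
have h2 : has (le_pair^~ y) (if c2 then [:: (a, b.+1)] else [::]) = le_pair (a, b.+1) y.
  rewrite /c2; case: allP => /= [_|/allP]; first by rewrite orbF.
  case/allPn => z zl zb; apply/esym/negP => xy; have := n1 _ zl.
  by have := l1x _ zl; move: xy zb; rewrite /before /le_pair /=; lia.
have h1 : has (le_pair^~ y) (if c1 then [:: (a.+1, b)] else [::]) = le_pair (a.+1, b) y.
  rewrite /c1; case: allP => /= [_|/allP]; first by rewrite orbF.
  case/allPn => z zl za; apply/esym/negP => xy; have := n2 _ zl.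
  by have := xl2 _ zl; move: xy za; rewrite /before /le_pair /=; lia.
rewrite h1 h2; case: y {n1 n2 h1 h2} => u v; rewrite xpair_eqE /le_pair /=.
lia.
Qed.

Lemma insert_afterE (x y : nat * nat) (l1 l2 : seq (nat * nat)) :
  x \notin l1 -> insert_after x y (l1 ++ x :: l2) = l1 ++ x :: y :: l2.
Proof.
move=> xl; rewrite /insert_after index_cat (negbTE xl) /= eqxx addn0.
by rewrite -cat1s catA -(addn1 (size l1)) -(size_cat l1 [:: x])
  take_size_cat // drop_size_cat // -catA.
Qed.

(** First coordinates increase along [l2], so testing its head tests all of it; an empty [l2] gives
    the default [+oo]. *)
Lemma successorE (l1 l2 : seq (nat * nat)) (a b : nat) :
    (a, b) \notin l1 -> pairwise before l2 ->
  ((a.+1%:Z)%:E < (successor (a, b) (l1 ++ (a, b) :: l2)).1)%E =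
  all (fun y => a.+1 < y.1)%N l2.
Proof.
move=> xl; rewrite /successor index_cat (negbTE xl) /= eqxx addn0 map_cat nth_cat.
rewrite size_map ltnNge leqnSn /= subSnn /=; case: l2 => [|y l2] /=; first by rewrite ltry.
case/andP => /allP yl2 _; rewrite lte_fin ltz_nat.
case: ltnP => //= ay; apply/esym/allP => z /yl2; rewrite /before; lia.
Qed.

Lemma predecessorE (l1 l2 : seq (nat * nat)) (a b : nat) :
    (a, b) \notin l1 -> pairwise before l1 ->
  ((b.+1%:Z)%:E < (predecessor (a, b) (l1 ++ (a, b) :: l2)).2)%E =
  all (fun y => b.+1 < y.2)%N l1.
Proof.
move=> xl; rewrite /predecessor index_cat (negbTE xl) /= eqxx addn0 map_cat.
rewrite -cat_cons nth_cat /= size_map ltnSn.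
case/lastP: l1 {xl} => [|l1 y] /=; first by rewrite ltry.
rewrite pairwise_rcons map_rcons size_rcons -rcons_cons /= nth_rcons size_map ltnn eqxx.
case/andP => /allP yl1 _; rewrite lte_fin ltz_nat all_rcons.
case: ltnP => //= ay; apply/esym/allP => z /yl1; rewrite /before; lia.
Qed.

Lemma split_notin (T : eqType) (x : T) (l : seq T) :
  x \in l -> exists l1 l2, x \notin l1 /\ l = l1 ++ x :: l2.
Proof.
move=> xl; exists (take (index x l) l), (drop (index x l).+1 l); split.
  by rewrite in_take_leq ?index_size // ltnn.
by rewrite -[in LHS](cat_take_drop (index x l) l) (drop_nth x) ?index_mem ?nth_index.
Qed.

Lemma rem_cat_cons (T : eqType) (x : T) (l1 l2 : seq T) :
  x \notin l1 -> rem x (l1 ++ x :: l2) = l1 ++ l2.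
Proof.
by elim: l1 => [|y l1 IH] /=; rewrite ?eqxx // inE eq_sym negb_or =>
  /andP[/negbTE-> /IH->].
Qed.

(** * The loop invariant *)

(** [enumerates_neq0] keeps the queue from running empty, so each iteration outputs one pair;
    [enumerates_le] supplies the comparisons between inside and outside used for counting. *)
Record enumerates (f : nat * nat -> int) (k : nat) (s : state) : Prop := Enumerates {
  enumerates_size : size (outputs s) = k;
  enumerates_uniq : uniq (outputs s);
  enumerates_frontier : frontier (outputs s) (Mlist s);
  enumerates_neq0 : Mlist s != [::];
  enumerates_queue : perm_eq (Fqueue s) [seq (f x, x) | x <- Mlist s];
  enumerates_le : forall x y,
    x \in outputs s -> y \notin outputs s -> f x <= f y }.

Section Run.

Variable f : nat * nat -> int.
Hypothesis f_mono : {homo f : x y / le_pair x y >-> x <= y}.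

Lemma enumerates_init : enumerates f 0 (init f).
Proof. by split => //; split => // y; rewrite /= /le_pair. Qed.

(** The first insertion goes after [(a, b)] and leaves its predecessor unchanged; the second, made
    at the same place, puts [(a, b.+1)] in front of [(a.+1, b)], as the order of [M] requires. *)
Lemma process_cat (a b : nat) (l1 l2 O : seq (nat * nat)) (F : seq (int * (nat * nat))) :
  (a, b) \notin l1 -> pairwise before l1 -> pairwise before l2 ->
  let c1 := all (fun y => a.+1 < y.1)%N l2 in
  let c2 := all (fun y => b.+1 < y.2)%N l1 in
  process f (f (a, b), (a, b)) (State (l1 ++ (a, b) :: l2) F O) =
  State (l1 ++ (if c2 then [:: (a, b.+1)] else [::]) ++
               (if c1 then [:: (a.+1, b)] else [::]) ++ l2)
        ((if c2 then [:: (f (a, b.+1), (a, b.+1))] else [::]) ++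
         (if c1 then [:: (f (a.+1, b), (a.+1, b))] else [::]) ++
         rem (f (a, b), (a, b)) F)
        (rcons O (a, b)).
Proof.
move=> xl1 p1 p2 c1 c2; rewrite /process /= successorE // -/c1.
by case: c1; rewrite ?insert_afterE // predecessorE // -/c2; case: c2;
  rewrite ?insert_afterE // rem_cat_cons.
Qed.

Lemma enumerates_process (k : nat) (s : state) (e : int * (nat * nat)) :
  enumerates f k s -> minimal_entry e (Fqueue s) -> enumerates f k.+1 (process f e s).
Proof.
case: s => M F O [/= szO uO OM M0 FM sepO] [eF emin].
have : e \in [seq (f x, x) | x <- M] by rewrite -(perm_mem FM).
case/mapP => -[a b] xM ee; subst e.
have xO := frontier_notin _ _ OM _ xM.
have [l1 [l2 [xl1 eM]]] := split_notin _ _ _ xM; subst M.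
have [+ _] := OM; rewrite pairwise_cat /= => /and4P[_ p1 _ p2].
rewrite process_cat //; split => /=.
- by rewrite size_rcons szO.
- by rewrite rcons_uniq xO.
- exact: frontier_rcons.
- by case: (l1).
- rewrite !map_cat (_ : [seq (f x, x) | x <- if _ then _ else _] = if
    all (fun y => b.+1 < y.2)%N l1 then [:: (f (a, b.+1), (a, b.+1))] else [::]);
    last by case: ifP.
  rewrite (_ : [seq (f x, x) | x <- if _ then _ else _] = if
    all (fun y => a.+1 < y.1)%N l2 then [:: (f (a.+1, b), (a.+1, b))] else [::]);
    last by case: ifP.
  rewrite perm_sym perm_catCA perm_cat2l perm_catCA perm_cat2l.
  rewrite -(perm_cons (f (a, b), (a, b))) perm_sym.
  rewrite -(permPl (perm_to_rem eF)) (permPl FM) map_cat /=.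
  by rewrite -cat1s perm_catCA.
- move=> x y; rewrite !mem_rcons !inE negb_or => xin /andP[_ yO].
  case/orP: xin => [/eqP->|xin]; last exact: sepO.
  (* A pair outside lies above a corner [z], and [f (a, b) <= f z] by minimality in the queue. *)
  have := yO; have [_ ->] := OM; case/hasP => z zM /f_mono; apply: le_trans.
  by apply: (emin (f z, z)); rewrite (perm_mem FM); apply: map_f.
Qed.

Lemma enumerates_run (s : nat -> state) : run f s -> forall k, enumerates f k (s k).
Proof.
case=> s0 hs; elim=> [|k IH]; first by rewrite s0; exact: enumerates_init.
case: (hs k) => [[F0 _]|[e [he ->]]]; last exact: enumerates_process IH he.
have := enumerates_queue _ _ _ IH; rewrite F0 => /perm_size/esym/eqP.
by rewrite size_map size_eq0 (negbTE (enumerates_neq0 _ _ _ IH)).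
Qed.

End Run.

(** * Increments of monotone polynomials *)

Lemma growth_weaken (d C N C' N' : nat) (P : nat -> nat) :
  (C <= C')%N -> (N <= N')%N -> growth d C N P -> growth d C' N' P.
Proof.
move=> CC' NN' [P0 Pm hup hlo]; split=> // a.
  apply: leq_trans (hup a) _; rewrite leq_add2l leq_mul2r CC'; exact: orbT.
move=> Na; have := hlo a (leq_trans NN' Na); have := Pm _ _ (leqnSn a); nia.
Qed.

(** Induction through (x+1)^(i+2) - x^(i+2) = (x+1) ((x+1)^(i+1) - x^(i+1)) + x^(i+1). *)
Lemma exprS_diff_bounds (R : realDomainType) (x : R) (i : nat) : 0 <= x ->
  x ^+ i <= (x + 1) ^+ i.+1 - x ^+ i.+1 <= i.+1%:R * (x + 1) ^+ i.
Proof.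
move=> x0; have xi : 0 <= x ^+ i by apply: exprn_ge0.
elim: i xi => [|i IH] xi; first by rewrite !expr1 !expr0 mulr1; lra.
have xi' : 0 <= x ^+ i by apply: exprn_ge0.
have /andP[lo hi] := IH xi'.
have xx : x ^+ i.+1 <= (x + 1) ^+ i.+1 by rewrite lerXn2r ?nnegrE; lra.
have xi1 : 0 <= (x + 1) ^+ i by apply: exprn_ge0; lra.
rewrite (exprS (x + 1) i.+1) (exprS x i.+1) -[i.+2%:R]natr1; apply/andP; split.
  by move: lo xx; set u := (x + 1) ^+ i.+1; set v := x ^+ i.+1; nra.
have : (x + 1) * ((x + 1) ^+ i.+1 - x ^+ i.+1) <= (x + 1) * (i.+1%:R * (x + 1) ^+ i).
  by apply: ler_wpM2l => //; lra.
move: xx; rewrite [(x + 1) ^+ i.+1]exprS.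
set u := (x + 1) ^+ i; set v := x ^+ i.+1; set n := i.+1%:R; nra.
Qed.

Section PolyDifference.

Variables (R : realType) (p : {poly R}) (d : nat).
Hypothesis szp : size p = d.+2.

Let S : R := d.+2%:R * \sum_(i < d.+2) `|p`_i|.

Let S_ge0 : 0 <= S.
Proof. by rewrite mulr_ge0 // sumr_ge0. Qed.

Lemma poly_diffE (x : R) :
  p.[x + 1] - p.[x] = \sum_(i < d.+2) p`_i * ((x + 1) ^+ i - x ^+ i).
Proof.
by rewrite !horner_coef szp -sumrB; apply: eq_bigr => i _; rewrite mulrBr.
Qed.

(** The factor [x + 1] on the left stands for the exponent [n - 1] on the right and keeps [n = 0]
    uniform. The case [n = d.+1] bounds the whole difference, [n = d] the terms below the leading
    one. *)
Lemma sum_diff_le (n : nat) (x : R) : 0 <= x -> (n <= d.+1)%N ->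
  `|\sum_(i < n.+1) p`_i * ((x + 1) ^+ i - x ^+ i)| * (x + 1) <= S * (x + 1) ^+ n.
Proof.
move=> x0 nd; have x1 : 0 <= x + 1 by lra.
rewrite -{2}(ger0_norm x1) -normrM mulr_suml.
apply: le_trans (ler_norm_sum _ _ _) _.
have le_S : d.+2%:R * \sum_(i < n.+1) `|p`_i| <= S.
  rewrite /S ler_wpM2l // -!(big_mkord xpredT (fun i => `|p`_i|)).
  by rewrite [leRHS](big_cat_nat _ (n := n.+1)) //= lerDl sumr_ge0.
apply: le_trans (ler_wpM2r _ le_S); last exact: exprn_ge0.
rewrite -mulrA mulrCA mulr_suml; apply: ler_sum => -[i /= ile] _.
rewrite !normrM -mulrA ler_wpM2l //.
rewrite (ger0_norm x1); case: i ile => [|i] ile.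
  by rewrite !expr0 subrr normr0 mul0r mulr_ge0 // exprn_ge0.
have /andP[lo hi] := exprS_diff_bounds R x i x0.
have xi : 0 <= x ^+ i by exact: exprn_ge0.
rewrite ger0_norm; last exact: le_trans lo.
apply: le_trans (ler_wpM2r x1 hi) _.
rewrite -mulrA -exprSr; apply: ler_pM; rewrite ?exprn_ge0 ?ler_nat //.
  lia.
by rewrite ler_weXn2l //; lra.
Qed.

Lemma poly_diff_ub (x : R) : 0 <= x -> p.[x + 1] - p.[x] <= S * (x + 1) ^+ d.
Proof.
move=> x0; rewrite poly_diffE; have := sum_diff_le d.+1 x x0 (leqnn _).
rewrite exprSr mulrA ler_pM2r; last by lra.
by apply: le_trans; exact: ler_norm.
Qed.

Lemma poly_diff_lead (x : R) : 1 <= x ->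
  exists2 r, `|r| * (x + 1) <= S * 2 ^+ d * x ^+ d &
    exists2 g, x ^+ d <= g & p.[x + 1] - p.[x] = lead_coef p * g + r.
Proof.
move=> x1; have x0 : 0 <= x by lra.
rewrite poly_diffE big_ord_recr /= lead_coefE szp /= [_ + p`_d.+1 * _]addrC.
eexists; last first.
  by eexists; last reflexivity; have /andP[] := exprS_diff_bounds R x d x0.
apply: le_trans (sum_diff_le d x x0 (leqnSn _)) _.
rewrite -mulrA -exprMn ler_wpM2l // lerXn2r ?nnegrE; lra.
Qed.

(* A negative leading coefficient is refuted by monotonicity: it would make the
   difference eventually negative. *)
Lemma poly_diff_lb : {homo (fun a : nat => p.[a%:R]) : a b / (a <= b)%N >-> a <= b} ->
  exists2 l, 0 < l & exists N : nat, forall a : nat, (N <= a)%N ->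
    l * a%:R ^+ d <= p.[a.+1%:R] - p.[a%:R].
Proof.
move=> pm; set T := S * 2 ^+ d.
have T0 : 0 <= T by rewrite mulr_ge0 // exprn_ge0.
have l0 : lead_coef p != 0 by rewrite lead_coef_eq0 -size_poly_eq0 szp.
set l := `|lead_coef p|; have lp : 0 < l by rewrite normr_gt0.
(* From here on the lower-order remainder is less than half of the leading contribution. *)
have small (a : nat) : (Num.bound (2 * T / l) <= a)%N -> 2 * T < l * (a%:R + 1).
  move=> Na; rewrite [l * _]mulrC -ltr_pdivrMr //.
  apply: (lt_trans (archi_boundP _)); first by apply: divr_ge0; [lra|exact: ltW].
  by rewrite natr1 ltr_nat ltnS.
exists (l / 2); first by rewrite divr_gt0.
exists (Num.bound (2 * T / l)).+1 => a Na.
have a1 : 1 <= a%:R :> R by rewrite ler1n; lia.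
have [r rle [g gle]] := poly_diff_lead a%:R a1; rewrite natr1 => dE.
have pge : 0 <= p.[a.+1%:R] - p.[a%:R] by rewrite subr_ge0; apply: pm.
have xd : 0 < a%:R ^+ d :> R by rewrite exprn_gt0; lra.
have {}rle : `|r| < l / 2 * a%:R ^+ d.
  have := small a ltac:(lia); move: rle; rewrite -/T.
  move: xd a1 T0; set x := a%:R; set u := x ^+ d => xd a1 T0 rle ls.
  rewrite -(ltr_pM2r (_ : 0 < x + 1)); last by lra.
  by apply: le_lt_trans rle _; nra.
have rb : - `|r| <= r <= `|r| by rewrite -ler_norml.
have [lpos|lneg] := ltP 0 (lead_coef p).
  move: lp rle; rewrite dE /l gtr0_norm // => lp rle; nra.
exfalso; move: lp rle; rewrite /l ler0_norm // => lp rle; nra.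
Qed.

End PolyDifference.

Lemma poly_growth (R : realType) (p : {poly R}) (d : nat) (P : nat -> nat) :
    size p = d.+2 ->
    {homo (fun a : nat => p.[a%:R]) : a b / (a <= b)%N >-> a <= b} ->
    (forall a, (P a)%:R = p.[a%:R] - p.[0]) ->
  exists C N, growth d C N P.
Proof.
move=> szp pm hP.
have [l l0 [N hN]] := poly_diff_lb R p d szp pm.
set S : R := d.+2%:R * \sum_(i < d.+2) `|p`_i|.
(* [S] serves the upper bound on increments, [l^-1] the lower one. *)
exists (Num.bound S + Num.bound l^-1)%N, N.
have Sb : S < (Num.bound S)%:R by apply: archi_boundP; rewrite mulr_ge0 // sumr_ge0.
have lb : l^-1 < (Num.bound l^-1)%:R by apply: archi_boundP; rewrite invr_ge0 ltW.
split.
- by apply/eqP; rewrite -(eqr_nat R) hP subrr.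
- by move=> a b ab; rewrite -(ler_nat R) !hP lerB // pm.
- move=> a; rewrite -(ler_nat R) natrD natrM natrX !hP.
  have := poly_diff_ub R p d szp a%:R (ler0n _ _); rewrite natr1 -/S => ub.
  have : S * a.+1%:R ^+ d <= (Num.bound S + Num.bound l^-1)%:R * a.+1%:R ^+ d.
    apply: ler_wpM2r; first by rewrite exprn_ge0.
    by rewrite natrD; have := ler0n R (Num.bound l^-1); lra.
  lra.
- move=> a Na; rewrite -(ler_nat R) natrD !natrM natrX !hP.
  have ad : a%:R ^+ d <= l^-1 * (p.[a.+1%:R] - p.[a%:R]).
    by rewrite ler_pdivlMl ?hN.
  have pge : 0 <= p.[a.+1%:R] - p.[a%:R] by rewrite subr_ge0; apply: pm.
  have : l^-1 * (p.[a.+1%:R] - p.[a%:R]) <=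
      (Num.bound S + Num.bound l^-1)%:R * (p.[a.+1%:R] - p.[a%:R]).
    by apply: ler_wpM2r => //; rewrite natrD; have := ler0n R (Num.bound S); lra.
  lra.
Qed.

(** * From queue lengths to the asymptotic bound *)

Lemma memory_bounds (R : realType) (p q : {poly R}) (d e : nat)
    (f : nat * nat -> int) (s : nat -> state) :
    (forall a b : nat, (f (a, b))%:~R = p.[a%:R] + q.[b%:R] :> R) ->
    (forall a a' : nat, (a <= a')%N -> p.[a%:R] <= p.[a'%:R]) ->
    (forall b b' : nat, (b <= b')%N -> q.[b%:R] <= q.[b'%:R]) ->
    size p = d.+2 -> size q = e.+2 -> (d <= e)%N -> run f s ->
  exists2 K, (0 < K)%N & forall n, (0 < n)%N ->
    (n ^ d.+1 <= K * memory s n ^ (d.+1 + e.+1))%N /\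
    (memory s n ^ (d.+1 + e.+1) <= K * n ^ d.+1)%N.
Proof.
move=> hf pm qm szp szq de hs.
have f_mono : {homo f : x y / le_pair x y >-> x <= y}.
  move=> [a b] [a' b'] /andP[/= aa' bb'].
  by rewrite -(ler_int R) !hf lerD ?pm ?qm.
have P_ge0 a : 0 <= f (a, 0)%N - f (0, 0)%N by rewrite subr_ge0 f_mono.
have Q_ge0 b : 0 <= f (0, b)%N - f (0, 0)%N by rewrite subr_ge0 f_mono.
(* Since [f] is integer-valued, [p] and [q] shifted to vanish at 0 take natural values, read off
   along the axes. *)
pose P a := `|f (a, 0)%N - f (0, 0)%N|%N.
pose Q b := `|f (0, b)%N - f (0, 0)%N|%N.
have PE a : (P a)%:R = p.[a%:R] - p.[0] :> R.
  by rewrite -[LHS]/((Posz (P a))%:~R) gez0_abs // rmorphB /= !hf mulr0n; lra.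
have QE b : (Q b)%:R = q.[b%:R] - q.[0] :> R.
  by rewrite -[LHS]/((Posz (Q b))%:~R) gez0_abs // rmorphB /= !hf mulr0n; lra.
have [CP [NP hP]] := poly_growth R p d P szp pm PE.
have [CQ [NQ hQ]] := poly_growth R q e Q szq qm QE.
have {}hP := growth_weaken _ _ _ (CP + CQ) (NP + NQ) _ (leq_addr _ _) (leq_addr _ _) hP.
have {}hQ := growth_weaken _ _ _ (CP + CQ) (NP + NQ) _ (leq_addl _ _) (leq_addl _ _) hQ.
set C := (CP + CQ)%N in hP hQ; set N := (NP + NQ)%N in hP hQ.
have [K hK] : exists K, forall k, (0 < k)%N ->
    let m := size (Fqueue (s k)) in
    (k ^ d.+1 <= K * m ^ (d.+1 + e.+1))%N /\ (m ^ (d.+1 + e.+1) <= K * k ^ d.+1)%N.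
  eexists (_ + _)%N => k k0 /=.
  have [szO uO OM _ FM sepO] := enumerates_run f f_mono s hs k.
  have sep a b a' b' : (a, b) \in outputs (s k) -> (a', b') \notin outputs (s k) ->
      (P a + Q b <= P a' + Q b')%N.
    move=> i1 i2; have := sepO _ _ i1 i2.
    by rewrite -(ler_int R) -(ler_nat R) !natrD !PE !QE !hf; lra.
  have O0 : (0 < size (outputs (s k)))%N by rewrite szO.
  have := size_frontier_ub d e C N P Q hP hQ _ _ OM O0 sep.
  have := size_outputs_ub d e C N P Q hP hQ _ _ OM O0 sep de uO.
  rewrite szO (perm_size FM) size_map => ub lb; split.
    by apply: leq_trans ub _; rewrite leq_mul2r; apply/orP; right; exact: leq_addr.
  by apply: leq_trans lb _; rewrite leq_mul2r; apply/orP; right; exact: leq_addl.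
(* The lower bound uses the queue after [n] iterations, the upper one an index [k <= n] attaining
   the maximum. The successor ensures positivity and covers [k = 0], where the queue has length
   1. *)
exists K.+1 => // n n0; split.
  have [h _] := hK n n0; apply: (leq_trans h).
  rewrite leq_mul // leq_expn2r //.
  exact: (@leq_bigmax _ (fun k : 'I_n.+1 => size (Fqueue (s k))) ord_max).
have [k0 kE] : exists k : 'I_n.+1, memory s n = size (Fqueue (s k)).
  have := @bigop.eq_bigmax _ (fun k : 'I_n.+1 => size (Fqueue (s k))).
  by rewrite card_ord => /(_ isT)[k kE]; exists k.
rewrite kE; case: k0 {kE} => -[|k] /= kn.
  have [-> _] := hs; rewrite /= exp1n muln_gt0 expn_gt0 n0; lia.
have [_ h] := hK k.+1 isT; apply: (leq_trans h).
by rewrite leq_mul // leq_expn2r.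
Qed.

Lemma powR_root_le (R : realType) (K x y i j : nat) :
    (0 < j)%N -> (x ^ i <= K * y ^ j)%N ->
  x%:R `^ (i%:R / j%:R) <= K%:R `^ j%:R^-1 * y%:R :> R.
Proof.
move=> j0 h; have yE : y%:R = (y%:R ^+ j) `^ j%:R^-1 :> R.
  by rewrite -powR_mulrn // -powRrM divff ?powRr1 // pnatr_eq0 -lt0n.
rewrite yE -powRM ?exprn_ge0 // powRrM powR_mulrn //.
by apply: ge0_ler_powR; rewrite ?invr_ge0 ?nnegrE ?mulr_ge0 ?exprn_ge0 // -!natrX -natrM ler_nat.
Qed.

Lemma root_powR_le (R : realType) (K x y i j : nat) :
    (0 < j)%N -> (y ^ j <= K * x ^ i)%N ->
  y%:R <= K%:R `^ j%:R^-1 * x%:R `^ (i%:R / j%:R) :> R.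
Proof.
move=> j0 h; have yE : y%:R = (y%:R ^+ j) `^ j%:R^-1 :> R.
  by rewrite -powR_mulrn // -powRrM divff ?powRr1 // pnatr_eq0 -lt0n.
rewrite yE [x%:R `^ _]powRrM powR_mulrn // -powRM ?exprn_ge0 //.
by apply: ge0_ler_powR; rewrite ?invr_ge0 ?nnegrE ?mulr_ge0 ?exprn_ge0 // -!natrX -natrM ler_nat.
Qed.

Theorem proposition18 (R : realType) (p q : {poly R}) (alpha beta : nat)
    (f : nat * nat -> int)
    (hf : forall a b : nat, (f (a, b))%:~R = p.[a%:R] + q.[b%:R] :> R)
    (hp : forall a a' : nat, (a <= a')%N -> p.[a%:R] <= p.[a'%:R])
    (hq : forall b b' : nat, (b <= b')%N -> q.[b%:R] <= q.[b'%:R])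
    (dp : size p = alpha.+1) (dq : size q = beta.+1)
    (h1 : (1 <= alpha)%N) (h2 : (alpha <= beta)%N)
    (s : nat -> state) (hs : run f s) :
  ((fun n : nat => (memory s n)%:R) : nat -> R^o) \is
    'Theta_\oo ((fun n : nat => n%:R `^ (alpha%:R / (alpha + beta)%:R)) : nat -> R^o).
Proof.
case: alpha dp h1 h2 => // d dp _; case: beta dq => // e dq; rewrite ltnS => de.
have [K K0 hK] := memory_bounds R p q d e f s hf hp hq dp dq de hs.
set k : R := K%:R `^ (d.+1 + e.+1)%:R^-1.
have k0 : 0 < k by rewrite powR_gt0 // ltr0n.
apply/asboolP; exists (k^-1, k); first by rewrite /= invr_gt0 k0.
(* At n = 0 the queue has length 1 while the power vanishes. *)
exists 1%N => // n /= n0; have [lb ub] := hK n n0.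
rewrite ger0_norm ?powR_ge0 // ger0_norm //; split.
  rewrite ler_pdivrMl //; exact: powR_root_le lb.
exact: root_powR_le ub.
Qed.
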